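(* Fix $j\ge0$ and assume $\overline{\sigma}_jf=\overline{I}_jf$ (on all of $\mathcal{S}$) for all $f:\mathcal{S}\to[0,\infty]$. Then $$\mathcal{L}^+_{\overline{\sigma}_j}=\mathcal{L}_j=\mathcal{L}_j^G\qquad\text{and}\qquad\mathcal{L}_{\overline{\sigma}_j}=\mathcal{L}_j^K=\mathcal{L}_j^{K,G}=\mathcal{L}^+_{\overline{\sigma}_j}-\mathcal{L}^+_{\overline{\sigma}_j}.$$
   Context: Setting. Fix $s_0\in\mathbb{R}$ and a trajectory set $\mathcal{S}$, i.e. a (nonempty) set of real sequences $S=(S_i)_{i\ge0}$ with $S_0=s_0$. For $S\in\mathcal{S}$ and $j\ge0$ let $\mathcal{S}_{(S,j)}=\{\tilde S\in\mathcal{S}:\tilde S_i=S_i,\ 0\le i\le j\}$; the pair $(S,j)$ is called a node. Put $\Delta_iS=S_{i+1}-S_i$. For every node a set $\mathcal{H}_{(S,j)}$ of portfolios is given (depending only on the node, i.e. $\mathcal H_{(\tilde S,j)}=\mathcal H_{(S,j)}$ if $\tilde S\in\mathcal S_{(S,j)}$): its elements are sequences $H=(H_i)_{i\ge j}$ of functions $H_i:\mathcal{S}_{(S,j)}\to\mathbb{R}$ that are non-anticipative, i.e. $H_i(\tilde S)=H_i(\hat S)$ whenever $\tilde S_k=\hat S_k$ for $j\le k\le i$. The following is assumed: (H.1) $\alpha\mathcal{H}_{(S,j)}+\mathcal{H}_{(S,j)}\subseteq\mathcal{H}_{(S,j)}$ for all $\alpha\ge0$; (H.2) every $(H_i)_{i\ge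 j}$ with each $H_i$ constant on $\mathcal{S}_{(S,j)}$ with value $-1$, $0$ or $1$ belongs to $\mathcal{H}_{(S,j)}$; (H.3) if $(H_i)_{i\ge j}\in\mathcal{H}_{(S,j)}$ and $k\ge j$ then $(H_i|_{\mathcal{S}_{(S,k)}})_{i\ge k}\in\mathcal{H}_{(S,k)}$; (H.4) if $(H_i)_{i\ge j}\in\mathcal{H}_{(S,j)}$, $k\ge j$, $G_i=H_i$ for $j\le i\le k$ and $G_i=0$ for $i>k$, then $G\in\mathcal{H}_{(S,j)}$. Elementary functions. For $V\in\mathbb{R}$, $H\in\mathcal{H}_{(S,j)}$, $n\ge j$ let $\Pi^{V,H}_{j,n}(\tilde S)=V+\sum_{i=j}^{n-1}H_i(\tilde S)\Delta_i\tilde S$ for $\tilde S\in\mathcal{S}_{(S,j)}$; $\mathcal{D}_{(S,j)}$ is the set of all such functions, $\mathcal{D}_{(S,j)}^+$ its non-negative elements, $\mathcal{D}_{(S,j)}^-=-\mathcal{D}_{(S,j)}^+$, $\mathcal{E}_{(S,j)}=\mathcal{D}_{(S,j)}^+-\mathcal{D}_{(S,j)}^+$. $\mathcal{D}_j$ is the set of $f:\mathcal{S}\to\mathbb{R}$ with $f|_{\mathcal{S}_{(S,j)}}\in\mathcal{D}_{(S,j)}$ for all $S\in\mathcal{S}$; $\mathcal{D}_j^+$ its non-negative elements, $\mathcal{E}_j=\mathcal{D}_j^+-\mathcal{D}_j^+$. Functions in $\mathcal{D}_{(S,j)},\mathcal{E}_{(S,j)}$ are regarded as functions on $\mathcal{S}$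 by extending them by $0$. Standing assumption 1 (local $0$-neutrality): $\sup_{\tilde S\in\mathcal{S}_{(S,j)}}(\tilde S_{j+1}-S_j)\ge0\ge\inf_{\tilde S\in\mathcal{S}_{(S,j)}}(\tilde S_{j+1}-S_j)$ at every node. Then $I_jf(S)=V$ for $f\in\mathcal{D}_j^+$ with $f|_{\mathcal{S}_{(S,j)}}=\Pi^{V,H}_{j,n}$ is well defined, and $I_j$ extends linearly to $\mathcal{E}_j$. Norm and a.e. $Q$ is the set of functions $\mathcal{S}\to[-\infty,\infty]$, $P\subseteq Q$ the non-negative ones. Conventions: $0\cdot\infty=0$, $\infty+(-\infty)=\infty$, $u-v=u+(-v)$, $\inf\emptyset=\infty$. For $f\in P$, $\overline{I}_jf(S)=\inf\{\sum_{m\ge1}V^m: f\le\sum_{m\ge1}f_m\text{ on }\mathcal{S}_{(S,j)},\ f_m=\Pi^{V^m,H^m}_{j,n_m}\in\mathcal{D}_{(S,j)}^+\}$; for $f\in Q$, $\|f\|_j(S)=\overline{I}_j|f|(S)$ and $\|f\|=\|f\|_0$ (a constant). $E\subseteq\mathcal{S}$ is null if $\|\mathbf{1}_E\|=0$; ''a.e.'' means off a null set, and $\doteq$ denotes equality a.e. A property holds a.e. on $\mathcal{S}_{(S,j)}$ if the set $E$ of points of $\mathcal{S}_{(S,j)}$ where it fails satisfies $\|\mathbf{1}_E\|_j(S)=0$. Conditional integral. For $f\in Q$, $\overline{\sigma}_jf(S)=\inf\{\sum_{m\ge0}V^m: f\le\sum_{m\ge0}f_m\text{ on }\mathcal{S}_{(S,j)},\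 f_0=\Pi^{V^0,H^0}_{j,n_0}\in\mathcal{D}_{(S,j)}^-,\ f_m=\Pi^{V^m,H^m}_{j,n_m}\in\mathcal{D}_{(S,j)}^+\ (m\ge1)\}$ (for $f_0\in\mathcal D_{(S,j)}^-=-\mathcal D_{(S,j)}^+$, $H^0$ is the negative of a portfolio and $V^0=-I_j(-f_0)(S)$), and $\underline{\sigma}_jf=-\overline{\sigma}_j(-f)$. Standing assumption 2: $\overline{\sigma}_j0=0$ on $\mathcal{S}$ for all $j\ge0$. $\mathcal{L}_{\overline{\sigma}_j}=\{f\in Q:\overline{\sigma}_jf-\underline{\sigma}_jf=0\text{ a.e.}\}$, and $\mathcal{L}^+_{\overline{\sigma}_j}$ is the set of its non-negative elements. Classes. $\mathcal{M}_j(S)$ is the set of $v=\sum_{m\ge1}f_m$ with $f_m\in\mathcal{D}_j^+$ and $\sum_mI_jf_m(S)<\infty$; $\mathcal{M}_j$ is the set of $v=\sum_{m\ge1}f_m$ with $f_m\in\mathcal{D}_j^+$ and $\sum_mI_jf_m<\infty$ a.e. $\mathcal{L}_j$: all $f:\mathcal{S}\to[0,\infty]$ such that for a.e. $S$: for all $\epsilon>0$ there are $u,v\in\mathcal{M}_j(S)$ with $f=v-u$ a.e. on $\mathcal{S}_{(S,j)}$ and $\overline{I}_ju(S)\le\epsilon$. $\mathcal{L}_j^G$: all $f:\mathcal{S}\to[0,\infty]$ such that for each $\epsilon>0$ there are $u,v\in\mathcal{M}_j$ such that for a.e. $S$: $f=v-u$ a.e. on $\mathcal{S}_{(S,j)}$,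 $\overline{I}_ju(S)\le\epsilon$ and $\overline{I}_jv(S)<\infty$. $\mathcal{L}_j^K$: all $f\in Q$ such that for a.e. $S$: for all $\epsilon>0$ there are $u,v\in\mathcal{M}_j(S)$, $h\in\mathcal{E}_{(S,j)}$ with $f=h+v-u$ a.e. on $\mathcal{S}_{(S,j)}$ and $\overline{I}_ju(S)\le\epsilon$, $\overline{I}_jv(S)\le\epsilon$. $\mathcal{L}_j^{K,G}$: all $f\in Q$ such that for each $\epsilon>0$ there are $u,v\in\mathcal{M}_j$, $h\in\mathcal{E}_j$ such that for a.e. $S$: $f=h+v-u$ a.e. on $\mathcal{S}_{(S,j)}$ and $\overline{I}_ju(S),\overline{I}_jv(S)\le\epsilon$. *)

(* Defs.v *)
From mathcomp Require Import all_boot all_order all_algebra.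
From mathcomp Require Import all_classical all_reals all_analysis.

Set Implicit Arguments.
Unset Strict Implicit.
Unset Printing Implicit Defensive.

Import Order.TTheory GRing.Theory Num.Theory.

Local Open Scope classical_set_scope.
Local Open Scope ring_scope.

(* A set T of real sequences is also used as the type of its elements, so a
   trajectory is S : T and its i-th coordinate is \val S i. *)

Definition trajectory_set (R : realType) (s0 : R) (T : set (nat -> R)) : Prop :=
  T !=set0 /\ (forall x, T x -> x 0%N = s0).

Section Market.
Variables (R : realType) (T : set (nat -> R)).
Implicit Types (S : T) (j k n : nat) (H : nat -> T -> R) (f : T -> \bar R).

Definition node S j : set T :=
  [set S' | forall i, (i <= j)%N -> \val S' i = \val S i].

Definition increment S i : R := \val S i.+1 - \val S i.

Definition locally_0_neutral : Prop :=
  forall S j,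
    (ereal_inf [set (\val S' j.+1 - \val S j)%:E | S' in node S j] <= 0)%E /\
    (0 <= ereal_sup [set (\val S' j.+1 - \val S j)%:E | S' in node S j])%E.

(* A portfolio (H_i)_{i >= j} at the node (S, j) is encoded by a total
   H : nat -> T -> R of which only the values H i S' with j <= i and
   S' \in node S j are meaningful; portfolio_ext makes membership independent
   of the other values, so that HH S j stands for a set of sequences of functions
   on node S j. *)
Record portfolio_family (HH : T -> nat -> set (nat -> T -> R)) : Prop :=
  PortfolioFamily {
  portfolio_ext : forall S j H G, HH S j H ->
    (forall i S', (j <= i)%N -> node S j S' -> G i S' = H i S') -> HH S j G ;
  portfolio_node : forall S S' j, node S j S' -> HH S' j = HH S j ;
  portfolio_nonanticipative : forall S j H i S1 S2, HH S j H -> (j <= i)%N ->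
    node S j S1 -> node S j S2 ->
    (forall k, (j <= k <= i)%N -> \val S1 k = \val S2 k) -> H i S1 = H i S2 ;
  portfolio_cone : forall S j (a : R) H G, 0 <= a -> HH S j H -> HH S j G ->
    HH S j (fun i S' => a * H i S' + G i S') ;
  portfolio_const : forall S j (c : nat -> R),
    (forall i, (j <= i)%N -> c i \in [:: -1; 0; 1]) ->
    HH S j (fun i _ => c i) ;
  portfolio_restrict : forall S j k H, HH S j H -> (j <= k)%N -> HH S k H ;
  portfolio_stop : forall S j k H, HH S j H -> (j <= k)%N ->
    HH S j (fun i S' => if (i <= k)%N then H i S' else 0) }.

Definition wealth j n (V : R) H (S : T) : R :=
  V + \sum_(j <= i < n) H i S * increment S i.

Variable HH : T -> nat -> set (nat -> T -> R).

Definition represents S j (V : R) (g : T -> R) : Prop :=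
  exists H n, [/\ HH S j H, (j <= n)%N &
    forall S', node S j S' -> g S' = wealth j n V H S'].

(* D_(S,j) and its relatives, extended by 0 outside the node *)
Definition Dnode S j : set (T -> R) :=
  [set g | (exists V, represents S j V g) /\
           (forall S', ~ node S j S' -> g S' = 0)].
Definition Dnode_pos S j : set (T -> R) :=
  [set g | Dnode S j g /\ forall S', 0 <= g S'].
Definition Dnode_neg S j : set (T -> R) :=
  [set g | Dnode_pos S j (\- g)].
Definition Enode S j : set (T -> R) :=
  [set g \- h | g in Dnode_pos S j & h in Dnode_pos S j].

Definition Dglob j : set (T -> R) :=
  [set g | forall S, exists V, represents S j V g].
Definition Dglob_pos j : set (T -> R) :=
  [set g | Dglob j g /\ forall S, 0 <= g S].
Definition Eglob j : set (T -> R) :=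
  [set g \- h | g in Dglob_pos j & h in Dglob_pos j].

(* I_j on D_j^+: local 0-neutrality makes the represented V unique for
   non-negative g, so the choice made by xget is immaterial. *)
Definition Iop j (g : T -> R) (S : T) : R :=
  xget 0 [set V | represents S j V g].

Local Open Scope ereal_scope.

(* the sequences (f_m)_{m >= 1} of non-negative terms are indexed from 0 *)
Definition Ibar j f (S : T) : \bar R :=
  ereal_inf [set x : \bar R | exists (V : nat -> R) (g : nat -> T -> R),
    [/\ forall m, Dnode_pos S j (g m) /\ represents S j (V m) (g m),
        forall S', node S j S' -> f S' <= \sum_(0 <= m <oo) (g m S')%:E &
        x = \sum_(0 <= m <oo) (V m)%:E]].

Definition norm_at j f (S : T) : \bar R := Ibar j (fun S' => `|f S'|) S.

(* ||f|| = ||f||_0 is constant, since all trajectories start at s0 *)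
Definition null_set (E : set T) : Prop :=
  forall S, norm_at 0 (fun S' => (\1_E S' : R)%:E) S = 0.

Definition ae (P : T -> Prop) : Prop :=
  exists2 E, null_set E & forall S, ~ E S -> P S.

Definition ae_node S j (P : T -> Prop) : Prop :=
  norm_at j (fun S' => (\1_(node S j `&` [set S1 | ~ P S1]) S' : R)%:E) S = 0.

(* For g 0 in D^-, it is - g 0 that is represented by an actual portfolio, with
   initial value - V 0. *)
Definition sigma_up j f (S : T) : \bar R :=
  ereal_inf [set x : \bar R | exists (V : nat -> R) (g : nat -> T -> R),
    [/\ Dnode_neg S j (g 0%N) /\
          represents S j (- V 0%N)%R (fun S' => (- g 0%N S')%R),
        forall m, (1 <= m)%N ->
          Dnode_pos S j (g m) /\ represents S j (V m) (g m),
        forall S', node S j S' -> f S' <= \sum_(0 <= m <oo) (g m S')%:E &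
        x = \sum_(0 <= m <oo) (V m)%:E]].

Definition sigma_low j f (S : T) : \bar R :=
  - sigma_up j (fun S' => - f S') S.

(* Differences of extended-real functions use the dual addition, for which
   +oo + -oo = +oo. *)
Definition Lsigma j : set (T -> \bar R) :=
  [set f : T -> \bar R | ae (fun S => (sigma_up j f S - sigma_low j f S)%dE = 0)].
Definition Lsigma_pos j : set (T -> \bar R) :=
  [set f : T -> \bar R | Lsigma j f /\ forall S, 0 <= f S].
Definition Lsigma_pos_diff j : set (T -> \bar R) :=
  [set (fun S => (g S - h S)%dE) | g in Lsigma_pos j & h in Lsigma_pos j].

Definition Mat j S : set (T -> \bar R) :=
  [set v : T -> \bar R | exists g : nat -> T -> R,
    [/\ forall m, Dglob_pos j (g m),
        forall S', v S' = \sum_(0 <= m <oo) (g m S')%:E &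
        \sum_(0 <= m <oo) (Iop j (g m) S)%:E < +oo]].

Definition Mae j : set (T -> \bar R) :=
  [set v : T -> \bar R | exists g : nat -> T -> R,
    [/\ forall m, Dglob_pos j (g m),
        forall S', v S' = \sum_(0 <= m <oo) (g m S')%:E &
        ae (fun S => \sum_(0 <= m <oo) (Iop j (g m) S)%:E < +oo)]].

Definition L j : set (T -> \bar R) :=
  [set f : T -> \bar R | (forall S, 0 <= f S) /\
    ae (fun S => forall e : R, (0 < e)%R -> exists u v : T -> \bar R,
      [/\ Mat j S u, Mat j S v,
          ae_node S j (fun S' => f S' = (v S' - u S')%dE) &
          Ibar j u S <= e%:E])].

Definition LG j : set (T -> \bar R) :=
  [set f : T -> \bar R | (forall S, 0 <= f S) /\
    forall e : R, (0 < e)%R -> exists u v : T -> \bar R,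
      [/\ Mae j u, Mae j v & ae (fun S =>
        [/\ ae_node S j (fun S' => f S' = (v S' - u S')%dE),
            Ibar j u S <= e%:E & Ibar j v S < +oo])]].

Definition LK j : set (T -> \bar R) :=
  [set f : T -> \bar R |
    ae (fun S => forall e : R, (0 < e)%R ->
      exists (u v : T -> \bar R) (h : T -> R),
      [/\ Mat j S u /\ Mat j S v, Enode S j h,
          ae_node S j (fun S' => f S' = ((h S')%:E + v S' - u S')%dE),
          Ibar j u S <= e%:E & Ibar j v S <= e%:E])].

Definition LKG j : set (T -> \bar R) :=
  [set f : T -> \bar R |
    forall e : R, (0 < e)%R -> exists (u v : T -> \bar R) (h : T -> R),
      [/\ Mae j u, Mae j v, Eglob j h & ae (fun S =>
        [/\ ae_node S j (fun S' => f S' = ((h S')%:E + v S' - u S')%dE),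
            Ibar j u S <= e%:E & Ibar j v S <= e%:E])]].

End Market.

(* Main.v *)
Require Import Defs.
From mathcomp Require Import all_boot all_order all_algebra.
From mathcomp Require Import all_classical all_reals all_analysis.
From mathcomp Require Import ring lra.

Import Order.TTheory GRing.Theory Num.Theory.
Local Open Scope classical_set_scope.
Local Open Scope ring_scope.

(** Fix a node (S, j). The non-negative elementary functions, paired with their
    initial capitals, form a convex cone [elem]; a superhedge is a countable series of
    members of the cone minus one member. The upper integral [sigma_up] is sublinear
    and [sigma_up 0 = 0], so the functions whose upper and lower integrals are finite
    and equal ([has_integral]) form a vector space on which the integral is linear.
    It contains the elementary functions and their convergent series
    ([elem_series], [has_integral_elem_series]), and membership does not change on
    null sets ([has_integral_ae]). A null set at the node is one on which some series
    of finite price is infinite ([node_nullP]). Hence every function in the classes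
    L_j^G and L_j^(K,G), being built from such series, is integrable at almost every
    node, and so is a difference of integrable functions.

    The converse is a decomposition theorem. Let f >= 0 be integrable at the node.
    Since [sigma_up] and [Ibar] agree on non-negative functions, f has a majorant q_0
    that is a series of elementary functions with nearly the same integral. The
    difference q_0 - f is non-negative, integrable, and has a small integral, so the
    same argument applies to it, and again to the new difference. This exhausts f by
    an alternating series f = q_0 - u_0 + q_1 - u_1 + ...; the errors being summable,
    u = u_0 + u_1 + ... and v = q_0 + q_1 + ... are series of finite price, the first
    with a small integral, and f + u = v ([has_integral_ge0_diff]). This takes the
    place of the lattice operations of the Daniell theory, which the cone lacks. A
    signed f is subtracted from a near-optimal superhedge p - b, the non-negative
    difference is decomposed, and p is cut into a finite sum and a small tail
    ([has_integral_diff]).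

    To pass from nodes to global functions, note that D_j restricts functions one node
    at a time: a choice of one representative per node glues the decompositions
    ([glue_Dglob_pos]). Finally a function of L_j^(K,G) is p - q + v - u almost
    everywhere on almost every node; (p + v) and (q + u), altered on the exceptional
    points, exhibit it as a difference of two non-negative integrable functions
    ([LKG_diff]). The inclusions close into the two cycles
    L_sigma^+ <= L_j <= L_j^G <= L_sigma^+ and
    L_sigma <= L_j^K <= L_j^(K,G) <= L_sigma^+ - L_sigma^+ <= L_sigma. *)

(** * Series and dual addition of extended reals *)

Section series.
Set Implicit Arguments.
Unset Strict Implicit.
Variable R : realType.
Local Open Scope ereal_scope.

Lemma eseries_cons (F : nat -> \bar R) :
  -oo < F 0%N -> (forall m, 0 <= F m.+1) ->
  \sum_(0 <= m <oo) F m = F 0%N + \sum_(0 <= m <oo) F m.+1.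
Proof.
move=> F0 Fpos.
apply: cvg_lim; first exact: ereal_hausdorff.
rewrite -cvg_shiftS.
rewrite (_ : (fun n => _) = (fun n => F 0%N + \sum_(0 <= m < n) F m.+1)); last first.
  by apply/funext => n; rewrite big_nat_recl.
apply: cvgeD.
- have : 0 <= \sum_(0 <= m <oo) F m.+1 by exact: nneseries_ge0.
  by case: (F 0%N) F0 => [x||]//; case: (\sum_(0 <= _ <oo) _) => [y||].
- exact: cvg_cst.
- by apply: is_cvg_nneseries => m _ _.
Qed.

(** The terms may have any sign: this serves for prices that are not yet known to
    be non-negative. *)
Lemma eseries_two (F : nat -> \bar R) :
  (forall m, F m.+2 = 0) -> \sum_(0 <= m <oo) F m = F 0%N + F 1%N.
Proof.
move=> F2; apply: cvg_lim; first exact: ereal_hausdorff.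
rewrite -(cvg_shiftn 2).
rewrite (_ : (fun n => _) = (fun=> F 0%N + F 1%N)); first exact: cvg_cst.
by apply/funext => n; rewrite addn2 !big_nat_recl// big1 ?adde0.
Qed.

(** A single enumeration of the pairs serves every double series, so functions and
    their prices can be rearranged simultaneously. *)
Lemma nneseries_pair :
  exists e : nat -> nat * nat, forall F : nat -> nat -> \bar R,
    (forall k m, 0 <= F k m) ->
    \sum_(0 <= n <oo) F (e n).1 (e n).2 =
    \sum_(0 <= k <oo) \sum_(0 <= m <oo) F k m.
Proof.
have /card_esym/ppcard_eqP[e] := card_nat2.
exists e => F F0; rewrite nneseries_esumT//.
rewrite (eq_eseriesr (fun k _ => nneseries_esumT (F0 k))).
rewrite nneseries_esumT; last by move=> k; apply: esum_ge0.
rewrite esum_esum//.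
rewrite -(@reindex_esum R _ _ setT (setT `*`` (fun=> setT)) e (fun x => F x.1 x.2))//.
have -> : setT `*`` (fun=> setT) = [set: nat * nat] by apply/seteqP; split.
exact: 'bij_e.
Qed.

Lemma nneseries_tail_le (F : nat -> \bar R) (e : R) :
  (forall m, 0 <= F m) -> \sum_(0 <= m <oo) F m < +oo -> (0 < e)%R ->
  exists N, \sum_(0 <= m <oo) F (m + N)%N <= e%:E.
Proof.
move=> F0 Foo e0; apply: contrapT => /forallNP big.
suff : e%:E <= 0 by rewrite lee_fin leNgt e0.
have tail0 := nneseries_tail_cvg Foo (fun m _ => F0 m).
apply: (cvge_ge _ tail0); apply: nearW => N; rewrite -nneseries_addn//.
by have /negP := big N; rewrite -ltNge => /ltW.
Qed.

Lemma nneseries_geometric (a : nat -> R) (e : R) : (forall k, (0 <= a k)%R) ->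
  (forall k, (a k <= e / 2 ^+ k.+1)%R) ->
  exists2 b, (b <= e)%R & \sum_(0 <= k <oo) (a k)%:E = b%:E.
Proof.
move=> a0 ae.
have le_e : \sum_(0 <= k <oo) (a k)%:E <= e%:E.
  have /cvg_lim := @cvg_geometric_eseries_half R e 0.
  rewrite expr0 divr1 => <- //.
  apply: lee_nneseries => k _; first by rewrite lee_fin.
  by rewrite lee_fin addn1 natrX.
have aE : \sum_(0 <= k <oo) (a k)%:E = (fine (\sum_(0 <= k <oo) (a k)%:E))%:E.
  rewrite fineK// ge0_fin_numE ?(le_lt_trans le_e) ?ltry//.
  by apply: nneseries_ge0 => k _ _; rewrite lee_fin.
by exists (fine (\sum_(0 <= k <oo) (a k)%:E)); rewrite // -lee_fin -aE.
Qed.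

Lemma dadde_fin (x y : R) : (x%:E + y%:E)%dE = (x + y)%:E.
Proof. by []. Qed.

(** The left-hand side may be of the form +oo - oo, which counts as +oo; one of the
    two upper bounds is then +oo as well, because p, q are non-negative and b, c real. *)
Lemma dadde_le (x y p q : \bar R) (b c : R) : 0 <= p -> 0 <= q ->
  x <= p - b%:E -> y <= q - c%:E -> (x + y)%dE <= (p + q) - (b + c)%:E.
Proof.
case: p => [p||]//; case: q => [q||]// _ _; case: x => [x||]; case: y => [y||];
  rewrite ?leey ?leNye// ?dadde_fin !lee_fin => xp yq.
lra.
Qed.

Lemma daddeN_ge0 (x : \bar R) : 0 <= (x + - x)%dE.
Proof.
by case: x => [x||]; [rewrite dadde_fin subrr|exact: le0y|exact: le0y].
Qed.

Lemma oppe_dadde_le (x y : \bar R) : - (x + y)%dE <= (- x + - y)%dE.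
Proof.
case: x => [x||]; case: y => [y||]; try exact: leNye; try exact: leey.
by rewrite !dadde_fin lee_fin/= opprD.
Qed.

Lemma daddeE_ge0 (x y : \bar R) : 0 <= x -> 0 <= y -> (x + y)%dE = x + y.
Proof. by case: x => [x||]; case: y => [y||]. Qed.

Lemma dsube_ge0 (p x : \bar R) : x <= p -> 0 <= (p - x)%dE.
Proof.
case: p => [p||]; case: x => [x||] //; try by move=> _; exact: le0y.
by rewrite lee_fin => xp; rewrite dadde_fin lee_fin subr_ge0.
Qed.

Lemma dsubeK (p x : \bar R) : 0 <= x -> x <= p -> x + (p - x)%dE = p.
Proof.
case: p => [p||]; case: x => [x||]//= _ _.
by rewrite dadde_fin -EFinD subrKC.
Qed.

(** Once p and v are not +oo, all the quantities are real and the conclusion is an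
    identity of real numbers. *)
Lemma dsube_regroup (f p u v t : \bar R) (g b : R) :
  0 <= t -> 0 <= u -> 0 <= ((p - b%:E) - f)%dE ->
  ((p - b%:E) - f)%dE + u = v -> p = g%:E + t -> p != +oo -> v != +oo ->
  f = ((g - b)%:E + (t + u)%E - v)%dE.
Proof.
move=> t0 u0 r0 <- pE; case: p pE r0 => [p||] pE r0 //; last first.
  by case: t t0 pE.
case: t t0 pE r0 => [t||]// t0 [->] r0 _.
case: u u0 => [u||]// u0; last by rewrite addey// gt_eqF// (lt_le_trans _ r0)// ltNyr.
case: f r0 => [f||]//= r0; rewrite -?EFinD ?dadde_fin => _.
by congr EFin; ring.
Qed.

Lemma adde_dsubeK (x u : \bar R) : 0 <= u -> u != +oo -> ((x + u)%E - u)%dE = x.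
Proof.
case: u => [u||]// _ _; case: x => [x||]//=.
by rewrite -EFinD dadde_fin addrK.
Qed.

(** The equality includes the points where u = v = +oo: both sides are +oo there. *)
Lemma dsube_shuffle (p q : R) (u v : \bar R) : 0 <= u -> 0 <= v ->
  ((p - q)%:E + v - u)%dE = ((p%:E + v)%E - (q%:E + u)%E)%dE.
Proof.
case: u => [u||]//; case: v => [v||]// _ _.
by rewrite -?EFinD /= ?dadde_fin; congr EFin; ring.
Qed.

Lemma dsube_pos_neg (x : \bar R) : ((maxe x 0)%E - (maxe (- x) 0)%E)%dE = x.
Proof.
have [x0|x0] := leP 0 x.
- have -> : maxe (- x) 0 = 0 by apply/max_idPr; rewrite oppe_le0.
  by case: x x0 => [x||]// _; rewrite oppe0 -[0]/(0%:E) dadde_fin addr0.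
- have -> : maxe (- x) 0 = - x by apply/max_idPl; rewrite oppe_ge0 ltW.
  by rewrite oppeK; case: x x0 => [x||]// _; rewrite -[0]/(0%:E) dadde_fin add0r.
Qed.
End series.

(** * The cone of elementary functions at a node *)

Section elementary.
Set Implicit Arguments.
Unset Strict Implicit.
Variables (R : realType) (T : set (nat -> R)).
Variables (HH : T -> nat -> set (nat -> T -> R)).
Hypothesis portf : portfolio_family HH.
Variables (S : T) (j : nat).

Lemma node_refl : node S j S. Proof. by []. Qed.

Lemma represents_congr V g f : (forall S', node S j S' -> g S' = f S') ->
  represents HH S j V g -> represents HH S j V f.
Proof.
move=> gf [H [n [HHH jn gE]]]; exists H, n; split=> // S' nS'.
by rewrite -gf// gE.
Qed.

Lemma portfolio0 : HH S j (fun _ _ => 0).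
Proof. by apply: (portfolio_const portf) => i _; rewrite !inE eqxx orbT. Qed.

Lemma wealth0 n V (S' : T) : wealth j n V (fun _ _ => 0) S' = V.
Proof. by rewrite /wealth big1 ?addr0// => i _; rewrite mul0r. Qed.

Lemma represents0 : represents HH S j 0 (fun=> 0).
Proof.
exists (fun _ _ => 0), j; split => //; first exact: portfolio0.
by move=> S' _; rewrite wealth0.
Qed.

(** Stopping a portfolio and holding nothing afterwards changes no payoff, so the
    maturity can be postponed; two payoffs thereby get a common maturity and can be
    added. *)
Lemma represents_late V g : represents HH S j V g ->
  exists n, (j <= n)%N /\ forall N, (n <= N)%N ->
    exists H, HH S j H /\ forall S', node S j S' -> g S' = wealth j N V H S'.
Proof.
move=> [H [n [HHH jn gE]]]; exists n; split=> // N nN.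
move: jn; rewrite leq_eqVlt => /predU1P[jn|jn].
  exists (fun _ _ => 0); split; first exact: portfolio0.
  by move=> S' /gE ->; rewrite wealth0 /wealth big_geq ?addr0// jn.
case: n => [//|k] in jn gE nN *.
exists (fun i S' => if (i <= k)%N then H i S' else 0); split.
  exact: (portfolio_stop portf).
move=> S' /gE ->; rewrite /wealth; congr +%R.
rewrite [RHS](big_cat_nat (n:=k.+1)) //=; last exact: ltnW.
rewrite [X in _ = _ + X]big_nat_cond [X in _ = _ + X]big1 ?addr0.
  by apply: eq_big_nat => i /andP[_ ik]; rewrite -ltnS ik.
by move=> i /andP[/andP[ki _] _]; rewrite leqNgt ki mul0r.
Qed.

Lemma representsMD c V g W f : 0 <= c ->
  represents HH S j V g -> represents HH S j W f ->
  represents HH S j (c * V + W) (fun S' => c * g S' + f S').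
Proof.
move=> c0 /represents_late[n [jn gE]] /represents_late[m [jm fE]].
have [H [HHH {}gE]] := gE _ (leq_maxl n m).
have [G [HHG {}fE]] := fE _ (leq_maxr n m).
exists (fun i S' => c * H i S' + G i S'), (maxn n m); split.
- exact: (portfolio_cone portf).
- by rewrite leq_max jn.
- move=> S' nS'; rewrite gE// fE// /wealth.
  under [in RHS]eq_bigr do rewrite mulrDl -mulrA.
  by rewrite big_split/= -mulr_sumr; ring.
Qed.

(** The price V is kept next to the payoff g because the infima that define Ibar and
    sigma_up range over such pairs. *)
Definition elem (V : R) (g : T -> R) : Prop :=
  Dnode_pos HH S j g /\ represents HH S j V g.

Lemma elem_represents V g : (forall S', 0 <= g S') ->
  (forall S', ~ node S j S' -> g S' = 0) -> represents HH S j V g -> elem V g.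
Proof. by move=> g0 gN gV; split=> //; split=> //; split=> //; exists V. Qed.

Lemma elem_ge0 V g S' : elem V g -> 0 <= g S'. Proof. by case=> -[]. Qed.

Lemma elem_out V g S' : elem V g -> ~ node S j S' -> g S' = 0.
Proof. by case=> -[[_ + _] _]; apply. Qed.

Lemma elem0 : elem 0 (fun=> 0).
Proof. by apply: elem_represents => //; exact: represents0. Qed.

Lemma elemMD c V g W f : 0 <= c -> elem V g -> elem W f ->
  elem (c * V + W) (fun S' => c * g S' + f S').
Proof.
move=> c0 gV fW; apply: elem_represents.
- by move=> S'; rewrite addr_ge0 ?mulr_ge0 ?(elem_ge0 _ gV) ?(elem_ge0 _ fW).
- by move=> S' nS'; rewrite (elem_out gV) ?(elem_out fW)// mulr0 addr0.
- by apply: representsMD => //; [case: gV|case: fW].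
Qed.

Lemma elemD V g W f : elem V g -> elem W f -> elem (V + W) (fun S' => g S' + f S').
Proof.
move=> gV fW; have := elemMD ler01 gV fW.
by rewrite mul1r; under eq_fun do rewrite mul1r.
Qed.

Lemma elemZ c V g : 0 <= c -> elem V g -> elem (c * V) (fun S' => c * g S').
Proof.
move=> c0 gV; have := elemMD c0 gV elem0.
by rewrite addr0; under eq_fun do rewrite addr0.
Qed.

Lemma elem_sum V g N : (forall m, elem (V m) (g m)) ->
  elem (\sum_(0 <= m < N) V m) (fun S' => \sum_(0 <= m < N) g m S').
Proof.
move=> gV; elim: N => [|N IH].
  by rewrite big_geq//; under eq_fun do rewrite big_geq//; exact: elem0.
rewrite big_nat_recr//=.
rewrite (_ : (fun S' => _) = fun S' => \sum_(0 <= m < N) g m S' + g N S').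
  exact: elemD.
by apply/funext => S'; rewrite big_nat_recr.
Qed.

Lemma elem_restrict V g : (forall S', 0 <= g S') -> represents HH S j V g ->
  elem V (patch (fun=> 0) (node S j) g).
Proof.
move=> g0 gV; apply: elem_represents.
- by move=> S'; rewrite /patch; case: ifP.
- by move=> S' nS'; rewrite /patch ifF//; apply/negbTE/negP; rewrite inE.
- by apply: represents_congr gV => S' nS'; rewrite /patch ifT// inE.
Qed.

Hypothesis sigma0 : sigma_up HH j (fun=> 0%E) S = 0%E.

(** Buying f and selling g superhedges the zero claim at the price W - V, and
    sigma_up 0 = 0 forbids a negative price. *)
Lemma elem_mono V g W f : elem V g -> elem W f ->
  (forall S', node S j S' -> g S' <= f S') -> V <= W.
Proof.
move=> gV fW gf.
suff : (0 <= (W - V)%:E)%E by rewrite lee_fin subr_ge0.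
rewrite -sigma0; apply: ereal_inf_lbound.
pose two (X : Type) (a b c : X) (m : nat) := match m with 0 => a | 1 => b | _ => c end.
have two_sum (a b : R) : (\sum_(0 <= m <oo) (two R a b 0 m)%:E = (a + b)%:E)%E.
  by rewrite eseries_two.
exists (two R (- V) W 0), (two _ (fun S' => - g S') f (fun=> 0)); split.
- rewrite /= opprK; split.
    rewrite /Dnode_neg /=; case: gV => gV _.
    rewrite (_ : (\- _) = g)//; apply/funext => S' /=.
    by rewrite opprK.
  by apply: represents_congr (proj2 gV) => S' _; rewrite opprK.
- by case=> [//|[|m]] _ //=; exact: elem0.
- move=> S' nS'.
  rewrite (eq_eseriesr (g := fun m => (two R (- g S') (f S') 0 m)%:E)); last first.
    by move=> [|[|m]].
  by rewrite two_sum lee_fin addrC subr_ge0 gf.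
- by rewrite two_sum addrC.
Qed.

Lemma elem_cost_ge0 V g : elem V g -> 0 <= V.
Proof. by move=> gV; apply: (elem_mono elem0 gV) => S' _; exact: elem_ge0 gV. Qed.

Lemma represents_uniq V W g : (forall S', 0 <= g S') ->
  represents HH S j V g -> represents HH S j W g -> V = W.
Proof.
move=> g0 /(elem_restrict g0) gV /(elem_restrict g0) gW.
by apply/eqP; rewrite eq_le (elem_mono gV gW)// (elem_mono gW gV).
Qed.

(** * Convergent series of elementary functions *)

Local Open Scope ereal_scope.

(** The class M_j(S) as seen from the node alone, with the value of the integral. The
    function v is left free off the node. *)
Definition elem_series (v : T -> \bar R) (a : R) : Prop :=
  exists V g, [/\ forall m, elem (V m) (g m),
    forall S', node S j S' -> v S' = \sum_(0 <= m <oo) (g m S')%:E &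
    \sum_(0 <= m <oo) (V m)%:E = a%:E].

Lemma elem_fin_ge0 V g S' : elem V g -> 0 <= (g S')%:E.
Proof. by move=> gV; rewrite lee_fin (elem_ge0 _ gV). Qed.

Lemma elem_cost_fin_ge0 V g : elem V g -> 0 <= V%:E.
Proof. by move=> gV; rewrite lee_fin (elem_cost_ge0 gV). Qed.

Lemma elem_series_congr v w a : (forall S', node S j S' -> v S' = w S') ->
  elem_series v a -> elem_series w a.
Proof.
move=> vw [V [g [gV vE Va]]]; exists V, g; split=> // S' nS'.
by rewrite -vw// vE.
Qed.

Lemma elem_series_elem V g : elem V g -> elem_series (EFin \o g) V.
Proof.
move=> gV; exists (fun m => if m is 0%N then V else 0%R).
exists (fun m => if m is 0%N then g else (fun=> 0%R)); split.
- by case=> [//|m]; exact: elem0.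
- by move=> S' _; rewrite eseries_two// adde0.
- by rewrite eseries_two// adde0.
Qed.

Lemma elem_series_ge0 v a S' : elem_series v a -> node S j S' -> 0 <= v S'.
Proof.
move=> [V [g [gV vE _]]] /vE ->; apply: nneseries_ge0 => m _ _.
exact: elem_fin_ge0 (gV m).
Qed.

Lemma elem_series_cost_ge0 v a : elem_series v a -> (0 <= a)%R.
Proof.
move=> [V [g [gV _ Va]]]; rewrite -lee_fin -Va; apply: nneseries_ge0 => m _ _.
exact: elem_cost_fin_ge0 (gV m).
Qed.

Lemma elem_seriesD v a w b : elem_series v a -> elem_series w b ->
  elem_series (fun S' => v S' + w S') (a + b).
Proof.
move=> [V [g [gV vE Va]]] [W [f [fW wE Wb]]].
exists (fun m => V m + W m)%R, (fun m S' => g m S' + f m S')%R; split.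
- by move=> m; exact: elemD.
- move=> S' nS'; rewrite vE// wE// -nneseriesD//.
  + by move=> m _ _; exact: elem_fin_ge0 (gV m).
  + by move=> m _ _; exact: elem_fin_ge0 (fW m).
- rewrite EFinD -Va -Wb -nneseriesD//.
  + by move=> m _ _; exact: elem_cost_fin_ge0 (gV m).
  + by move=> m _ _; exact: elem_cost_fin_ge0 (fW m).
Qed.

Lemma elem_seriesZ c v a : (0 <= c)%R -> elem_series v a ->
  elem_series (fun S' => c%:E * v S') (c * a).
Proof.
move=> c0 [V [g [gV vE Va]]].
exists (fun m => c * V m)%R, (fun m S' => c * g m S')%R; split.
- by move=> m; exact: elemZ.
- move=> S' nS'; rewrite vE// -nneseriesZl//.
  by move=> m _; exact: elem_fin_ge0 (gV m).
- rewrite EFinM -Va -nneseriesZl//.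
  by move=> m _; exact: elem_cost_fin_ge0 (gV m).
Qed.

Lemma elem_series_sum v a b : (forall k, elem_series (v k) (a k)) ->
  \sum_(0 <= k <oo) (a k)%:E = b%:E ->
  elem_series (fun S' => \sum_(0 <= k <oo) v k S') b.
Proof.
move=> va ab.
have /choice[Vg {}va] : forall k, exists Vg : (nat -> R) * (nat -> T -> R),
    [/\ forall m, elem (Vg.1 m) (Vg.2 m),
      forall S', node S j S' -> v k S' = \sum_(0 <= m <oo) (Vg.2 m S')%:E &
      \sum_(0 <= m <oo) (Vg.1 m)%:E = (a k)%:E].
  by move=> k; have [V [g ?]] := va k; exists (V, g).
have el k m : elem ((Vg k).1 m) ((Vg k).2 m) by have [] := va k.
have [e eE] := nneseries_pair R.
exists (fun n => (Vg (e n).1).1 (e n).2), (fun n => (Vg (e n).1).2 (e n).2); split.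
- by move=> n.
- move=> S' nS'; rewrite (eE (fun k m => ((Vg k).2 m S')%:E)).
    by apply: eq_eseriesr => k _; have [_ ->] := va k.
  by move=> k m; exact: elem_fin_ge0 (el k m).
- rewrite (eE (fun k m => ((Vg k).1 m)%:E)).
    by rewrite -ab; apply: eq_eseriesr => k _; have [_ _ ->] := va k.
  by move=> k m; exact: elem_cost_fin_ge0 (el k m).
Qed.

(** The finite part g is what makes the negative of a series accessible: - v is at
    most - g, and - g may serve as the non-positive term of a superhedge. *)
Lemma elem_series_split v a e : elem_series v a -> (0 < e)%R ->
  exists V g b t, [/\ elem V g, elem_series t b, (b <= e)%R, (a = V + b)%R &
    forall S', node S j S' -> v S' = (g S')%:E + t S'].
Proof.
move=> [V [g [gV vE Va]]] e0.
have V0 m : 0 <= (V m)%:E by exact: elem_cost_fin_ge0 (gV m).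
have [|N VN] := nneseries_tail_le V0 _ e0; first by rewrite Va ltry.
have tail0 : 0 <= \sum_(0 <= m <oo) (V (m + N)%N)%:E.
  by apply: nneseries_ge0 => m _ _.
have tailE : \sum_(0 <= m <oo) (V (m + N)%N)%:E =
    (fine (\sum_(0 <= m <oo) (V (m + N)%N)%:E))%:E.
  by rewrite fineK// ge0_fin_numE// (le_lt_trans VN)// ltry.
exists (\sum_(0 <= m < N) V m)%R, (fun S' => \sum_(0 <= m < N) g m S')%R.
exists (fine (\sum_(0 <= m <oo) (V (m + N)%N)%:E)).
exists (fun S' => \sum_(0 <= m <oo) (g (m + N)%N S')%:E); split.
- exact: elem_sum.
- by exists (fun m => V (m + N)%N), (fun m => g (m + N)%N).
- by rewrite -lee_fin -tailE.
- apply: EFin_inj; rewrite EFinD -tailE -Va.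
  by rewrite (nneseries_split 0 N)//= add0n sumEFin; have <- := nneseries_addn N V0.
- move=> S' nS'; rewrite vE//.
  have g0 m : 0 <= (g m S')%:E by exact: elem_fin_ge0 (gV m).
  rewrite (nneseries_split 0 N)//= add0n sumEFin.
  by have <- := nneseries_addn N g0.
Qed.

(** * Upper integrals and null sets at a node *)

Lemma Ibar_leP f a : Ibar HH j f S <= a%:E <-> forall e : R, (0 < e)%R ->
  exists P p, [/\ elem_series p P, (P <= a + e)%R &
    forall S', node S j S' -> f S' <= p S'].
Proof.
split=> [fa e e0|fa].
  have : Ibar HH j f S < (a + e)%:E by rewrite (le_lt_trans fa)// lte_fin ltrDl.
  move=> /ereal_inf_lt[_ [V [g [gV fg ->]]] Vae].
  have V0 m : 0 <= (V m)%:E by exact: elem_cost_fin_ge0 (gV m).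
  have VE : \sum_(0 <= m <oo) (V m)%:E = (fine (\sum_(0 <= m <oo) (V m)%:E))%:E.
    by rewrite fineK// ge0_fin_numE ?nneseries_ge0// (lt_trans Vae)// ltry.
  exists (fine (\sum_(0 <= m <oo) (V m)%:E)).
  exists (fun S' => \sum_(0 <= m <oo) (g m S')%:E); split=> //; first by exists V, g.
  by rewrite -lee_fin -VE ltW.
apply/lee_addgt0Pr => e e0; have [P [p [[V [g [gV pE VP]]] Pae fp]]] := fa e e0.
apply: (@le_trans _ _ P%:E); last by rewrite -EFinD lee_fin.
apply: ereal_inf_lbound; exists V, g; split=> //.
by move=> S' nS'; rewrite -pE// fp.
Qed.

Lemma elem_series_Ibar_le v a : elem_series v a -> Ibar HH j v S <= a%:E.
Proof.
move=> va; apply/Ibar_leP => e e0; exists a, v; split=> //.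
by rewrite lerDl ltW.
Qed.

Lemma Ibar_ge0 f : 0 <= Ibar HH j f S.
Proof.
apply: le_ereal_inf_tmp => _ [V [g [gV _ ->]]]; apply: nneseries_ge0 => m _ _.
exact: elem_cost_fin_ge0 (gV m).
Qed.

(** With its single non-positive term set apart as - b, a superhedge becomes a series
    of non-negative terms, which can be rearranged, added and scaled freely. *)
Lemma sigma_up_leP f a : sigma_up HH j f S <= a%:E <-> forall e : R, (0 < e)%R ->
  exists B b P p, [/\ elem B b, elem_series p P, (P - B <= a + e)%R &
    forall S', node S j S' -> f S' <= p S' - (b S')%:E].
Proof.
split=> [fa e e0|fa].
  have : sigma_up HH j f S < (a + e)%:E by rewrite (le_lt_trans fa)// lte_fin ltrDl.
  move=> /ereal_inf_lt[_ [V [g [gV0 gV fg ->]]] Vae].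
  have el0 : elem (- V 0%N) (fun S' => - g 0%N S')%R by [].
  have el m : elem (V m.+1) (g m.+1) by exact: gV.
  have V0 m : 0 <= (V m.+1)%:E by exact: elem_cost_fin_ge0 (el m).
  rewrite eseries_cons ?ltNyr// in Vae.
  have VE : \sum_(0 <= m <oo) (V m.+1)%:E = (fine (\sum_(0 <= m <oo) (V m.+1)%:E))%:E.
    rewrite fineK// ge0_fin_numE ?nneseries_ge0// ltNge leye_eq; apply/eqP => oo.
    by rewrite oo in Vae.
  exists (- V 0%N)%R, (fun S' => - g 0%N S')%R.
  exists (fine (\sum_(0 <= m <oo) (V m.+1)%:E)).
  exists (fun S' => \sum_(0 <= m <oo) (g m.+1 S')%:E); split=> //.
  - by exists (fun m => V m.+1), (fun m => g m.+1).
  - by rewrite -lee_fin opprK addrC EFinD -VE ltW.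
  - move=> S' nS'; rewrite (le_trans (fg _ nS'))// eseries_cons ?ltNyr//.
      by rewrite EFinN oppeK addeC.
    by move=> m; exact: elem_fin_ge0 (el m).
apply/lee_addgt0Pr => e e0.
have [B [b [P [p [bB [V [g [gV pE VP]]] PBae fp]]]]] := fa e e0.
apply: (@le_trans _ _ (P - B)%:E); last by rewrite -EFinD lee_fin.
apply: ereal_inf_lbound.
exists (fun m => if m is m'.+1 then V m' else (- B)%R).
exists (fun m => if m is m'.+1 then g m' else (fun S' => - b S')%R); split.
- rewrite opprK /Dnode_neg /= (_ : (\- _)%R = b)//; last first.
    by apply/funext => S' /=; rewrite opprK.
  rewrite (_ : (fun S' => _) = b)//.
  by apply/funext => S' /=; rewrite opprK.
- by case=> [//|m] _; exact: gV.
- move=> S' nS'; rewrite eseries_cons ?ltNyr//; last first.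
    by move=> m; exact: elem_fin_ge0 (gV m).
  by rewrite (le_trans (fp _ nS'))// pE// EFinN addeC.
- rewrite eseries_cons ?ltNyr//; last first.
    by move=> m; exact: elem_cost_fin_ge0 (gV m).
  by rewrite VP addrC EFinD.
Qed.

(** A null set is described by one series of finite price that is infinite on it.
    Adding small multiples of that series to a superhedge costs little and removes
    every constraint on the set. *)
Definition node_null (N : T -> Prop) : Prop :=
  exists P p, elem_series p P /\ forall S', node S j S' -> N S' -> p S' = +oo.

Lemma node_null_sub (N M : T -> Prop) : (forall S', node S j S' -> N S' -> M S') ->
  node_null M -> node_null N.
Proof. by move=> NM [P [p [pP Moo]]]; exists P, p; split=> // S' nS' /NM; auto. Qed.

Lemma node_nullU (N M : T -> Prop) :
  node_null N -> node_null M -> node_null (fun S' => N S' \/ M S').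
Proof.
move=> [P [p [pP Noo]]] [Q [q [qQ Moo]]].
exists (P + Q)%R, (fun S' => p S' + q S'); split; first exact: elem_seriesD.
move=> S' nS' [/(Noo _ nS')|/(Moo _ nS')] ->.
- by rewrite addye// gt_eqF// (lt_le_trans _ (elem_series_ge0 qQ nS'))// ltNyr.
- by rewrite addey// gt_eqF// (lt_le_trans _ (elem_series_ge0 pP nS'))// ltNyr.
Qed.

Lemma node_null_small (N : T -> Prop) (e : R) : node_null N -> (0 < e)%R ->
  exists P p, [/\ elem_series p P, (P <= e)%R &
    forall S', node S j S' -> N S' -> p S' = +oo].
Proof.
move=> [P [p [pP Noo]]] e0.
have P0 := elem_series_cost_ge0 pP.
have P1 : (0 < P + 1)%R by lra.
exists (e / (P + 1) * P)%R, (fun S' => (e / (P + 1))%:E * p S'); split.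
- by apply: (elem_seriesZ _ pP); rewrite divr_ge0// ltW.
- by rewrite mulrAC ler_pdivrMr// ler_pM2l//; lra.
- by move=> S' nS' /(Noo _ nS') ->; rewrite gt0_muley// lte_fin divr_gt0.
Qed.

(** Summing majorants of the indicator with integrals at most 2^-k gives a series of
    finite price whose terms are all at least 1 on N. In the other direction,
    arbitrarily small multiples of a series infinite on N dominate the indicator. *)
Lemma node_nullP (N : set T) :
  Ibar HH j (fun S' => `|(\1_N S' : R)%:E|) S = 0 <-> node_null N.
Proof.
split=> [IN0|negN]; last first.
  apply/eqP; rewrite eq_le Ibar_ge0 andbT; apply/Ibar_leP => e e0.
  have [P [p [pP Pe Noo]]] := node_null_small negN e0.
  exists P, p; split=> //; first by rewrite add0r.
  move=> S' nS'; rewrite indicE; have [NS'|_] := boolP (S' \in N).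
    by rewrite (Noo S')// ?leey// -in_setE.
  by rewrite /= mulr0n normr0; exact: elem_series_ge0 pP nS'.
have /Ibar_leP small : Ibar HH j (fun S' => `|(\1_N S' : R)%:E|) S <= 0%:E.
  by rewrite IN0.
have /choice[p pE] : forall k : nat, exists Pp : R * (T -> \bar R),
    [/\ elem_series Pp.2 Pp.1, (Pp.1 <= 1 / 2 ^+ k.+1)%R &
      forall S', node S j S' -> `|(\1_N S' : R)%:E| <= Pp.2 S'].
  move=> k; have [|P [p [pP]]] := small (1 / 2 ^+ k.+1)%R.
    by rewrite divr_gt0// exprn_gt0.
  by rewrite add0r => Pk Np; exists (P, p).
have [k|k|b _ pb] := @nneseries_geometric R (fun k => (p k).1) 1.
- by have [/elem_series_cost_ge0] := pE k.
- by have [] := pE k.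
exists b, (fun S' => \sum_(0 <= k <oo) (p k).2 S'); split.
  by apply: elem_series_sum pb => k; have [] := pE k.
move=> S' nS' NS'; apply/eqP; rewrite eq_le leey /= leNgt.
apply/negP => fin.
have p1 k : 1 <= (p k).2 S'.
  have [_ _ /(_ S' nS')] := pE k.
  by rewrite indicE mem_set//= normr1.
have big n : n%:R%:E <= \sum_(0 <= k <oo) (p k).2 S'.
  apply: (@le_trans _ _ (\sum_(0 <= k < n) (p k).2 S')); last first.
    by apply: nneseries_lim_ge => k _ _; rewrite (le_trans _ (p1 k)).
  apply: (@le_trans _ _ (\sum_(0 <= k < n) 1)); last exact: lee_sum.
  by rewrite sumEFin big_const_nat iter_addr_0 subn0.
move: fin (big (Num.bound (fine (\sum_(0 <= k <oo) (p k).2 S')))).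
move: (big 0%N); case: (\sum_(0 <= _ <oo) _) => [x||]//=; rewrite !lee_fin => x0 _.
by rewrite leNgt archi_boundP.
Qed.

Lemma ae_nodeP (P : T -> Prop) :
  ae_node HH S j P <-> node_null (fun S' => ~ P S').
Proof.
rewrite /ae_node /norm_at node_nullP; split; apply: node_null_sub => S' nS' //.
by case.
Qed.

(** * Linearity of the integral at a node *)

Lemma sigma_up_mono f g a : (forall S', node S j S' -> f S' <= g S') ->
  sigma_up HH j g S <= a%:E -> sigma_up HH j f S <= a%:E.
Proof.
move=> fg /sigma_up_leP ga; apply/sigma_up_leP => e /ga[B [b [P [p [bB pP PB gp]]]]].
by exists B, b, P, p; split=> // S' nS'; rewrite (le_trans (fg _ nS'))// gp.
Qed.

(** To a superhedge of f one adds a cheap series that is infinite wherever f and g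
    differ. *)
Lemma sigma_up_ae f g a : node_null (fun S' => f S' <> g S') ->
  sigma_up HH j f S <= a%:E -> sigma_up HH j g S <= a%:E.
Proof.
move=> fg /sigma_up_leP fa; apply/sigma_up_leP => e e0.
have e20 : (0 < e / 2)%R by lra.
have [B [b [P [p [bB pP PB fp]]]]] := fa _ e20.
have [Q [q [qQ Qe qoo]]] := node_null_small fg e20.
exists B, b, (P + Q)%R, (fun S' => p S' + q S'); split=> //; [exact: elem_seriesD|lra|].
move=> S' nS'; have [<-|/(qoo _ nS') ->] := pselect (f S' = g S').
  rewrite (le_trans (fp _ nS'))// leeB// leeDl//; exact: elem_series_ge0 qQ nS'.
rewrite addey ?leey// gt_eqF// (lt_le_trans _ (elem_series_ge0 pP nS'))// ltNyr.
Qed.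

Lemma sigma_up_dadd f a g b : sigma_up HH j f S <= a%:E ->
  sigma_up HH j g S <= b%:E ->
  sigma_up HH j (fun S' => (f S' + g S')%dE) S <= (a + b)%:E.
Proof.
move=> /sigma_up_leP fa /sigma_up_leP gb; apply/sigma_up_leP => e e0.
have e20 : (0 < e / 2)%R by lra.
have [B [b' [P [p [bB pP PB fp]]]]] := fa _ e20.
have [C [c [Q [q [cC qQ QC gq]]]]] := gb _ e20.
exists (B + C)%R, (fun S' => b' S' + c S')%R, (P + Q)%R, (fun S' => p S' + q S').
split; [exact: elemD|exact: elem_seriesD|lra|].
move=> S' nS'; apply: dadde_le; [|
  |exact: fp|exact: gq]; [exact: elem_series_ge0 pP nS'|exact: elem_series_ge0 qQ nS'].
Qed.

(** The dual sum of f and - f is 0, or +oo where f is infinite; its upper integral is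
    therefore at least sigma_up 0 = 0. *)
Lemma sigma_up_opp_ge0 f a b : sigma_up HH j f S <= a%:E ->
  sigma_up HH j (fun S' => - f S') S <= b%:E -> (0 <= a + b)%R.
Proof.
move=> fa fb; rewrite -lee_fin -[leLHS]sigma0.
apply: sigma_up_mono (sigma_up_dadd fa fb) => S' _; exact: daddeN_ge0.
Qed.

(** The function is squeezed between its lower and upper integrals: both inequalities
    are equalities, by sigma_up_opp_ge0, and a being real excludes infinite values. *)
Definition has_integral f a : Prop :=
  sigma_up HH j f S <= a%:E /\ sigma_up HH j (fun S' => - f S') S <= (- a)%:E.

Lemma has_integralN f a : has_integral f a -> has_integral (fun S' => - f S') (- a).
Proof.
move=> [fa fNa]; split=> //; rewrite opprK.
by apply: sigma_up_mono fa => S' _; rewrite oppeK.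
Qed.

Lemma has_integral_sigma_up f a : has_integral f a -> sigma_up HH j f S = a%:E.
Proof.
move=> [fa fNa]; apply/eqP; rewrite eq_le fa /=; case E : sigma_up => [x||].
- have := @sigma_up_opp_ge0 f x (- a); rewrite E lee_fin lexx => /(_ isT fNa).
  by rewrite subr_ge0.
- by rewrite leey.
- have := @sigma_up_opp_ge0 f (a - 1) (- a); rewrite E leNye => /(_ isT fNa).
  by rewrite addrAC subrr add0r ler0N1.
Qed.

Lemma has_integralP f :
  (sigma_up HH j f S - sigma_low HH j f S)%dE = 0 <-> exists a, has_integral f a.
Proof.
rewrite /sigma_low oppeK; split=> [|[a fa]]; last first.
  rewrite (has_integral_sigma_up fa) (has_integral_sigma_up (has_integralN fa)).
  by rewrite dadde_fin subrr.
rewrite /has_integral; case: sigma_up => [x||]; case: sigma_up => [y||] //.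
move=> /(congr1 (@fine R)) /= /eqP; rewrite addrC addr_eq0 => /eqP ->.
by exists x.
Qed.

Lemma has_integral_ae f g a : node_null (fun S' => f S' <> g S') ->
  has_integral f a -> has_integral g a.
Proof.
move=> fg [fa fNa]; split; first exact: sigma_up_ae fa.
apply: sigma_up_ae fNa; apply: node_null_sub fg => S' nS' + fgE.
by apply; rewrite fgE.
Qed.

Lemma node_null0 (N : T -> Prop) : (forall S', node S j S' -> ~ N S') -> node_null N.
Proof.
move=> N0; exists 0%R, (EFin \o (fun=> 0%R)); split; first exact/elem_series_elem/elem0.
by move=> S' /N0.
Qed.

Lemma has_integral_congr f g a : (forall S', node S j S' -> f S' = g S') ->
  has_integral f a -> has_integral g a.
Proof. by move=> fg; apply: has_integral_ae; apply: node_null0 => S' /fg ->. Qed.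

Lemma has_integralD f a g b : has_integral f a -> has_integral g b ->
  has_integral (fun S' => (f S' + g S')%dE) (a + b).
Proof.
move=> [fa fNa] [gb gNb]; split; first exact: sigma_up_dadd.
rewrite opprD; apply: sigma_up_mono (sigma_up_dadd fNa gNb) => S' _.
exact: oppe_dadde_le.
Qed.

Lemma has_integralB f a g b : has_integral f a -> has_integral g b ->
  has_integral (fun S' => (f S' - g S')%dE) (a - b).
Proof. by move=> fa /has_integralN; exact: has_integralD. Qed.

Lemma has_integral_uniq f a b : has_integral f a -> has_integral f b -> a = b.
Proof.
move=> [fa fNa] [fb fNb].
have := sigma_up_opp_ge0 fa fNb; have := sigma_up_opp_ge0 fb fNa.
by clear fa fNa fb fNb; lra.
Qed.

(** The nontrivial half is the bound for - v, obtained from the negatives of the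
    partial sums of v. *)
Lemma has_integral_elem_series v a : elem_series v a -> has_integral v a.
Proof.
move=> va; split; apply/sigma_up_leP => e e0.
  exists 0%R, (fun=> 0%R), a, v; split=> //; first exact: elem0.
  - by lra.
  - by move=> S' _; rewrite sube0.
have [V [g [b [t [gV tb be ->] vE]]]] := elem_series_split va e0.
exists V, g, 0%R, (EFin \o (fun=> 0%R)); split=> //.
- exact/elem_series_elem/elem0.
- by lra.
- move=> S' nS'; rewrite vE// /= add0e EFinN.
  by rewrite leeN2 leeDl//; exact: elem_series_ge0 tb nS'.
Qed.

Lemma has_integral_elem V g : elem V g -> has_integral (EFin \o g) V.
Proof. by move=> /elem_series_elem/has_integral_elem_series. Qed.

Lemma elem_series_pinfty_null v a :
  elem_series v a -> node_null (fun S' => v S' = +oo).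
Proof. by move=> va; exists a, v. Qed.

(** * Decomposition of integrable functions *)

Hypothesis sigma_eq_I : forall f : T -> \bar R, (forall S', 0 <= f S') ->
  sigma_up HH j f S = Ibar HH j f S.

(** This is where the equality of sigma_up and Ibar on non-negative functions enters:
    a near-optimal superhedge of f can be chosen without its non-positive term. *)
Lemma ge0_dominated f a (e : R) : (forall S', node S j S' -> 0 <= f S') ->
  sigma_up HH j f S <= a%:E -> (0 < e)%R ->
  exists P p, [/\ elem_series p P, (P <= a + e)%R &
    forall S', node S j S' -> f S' <= p S'].
Proof.
move=> f0 fa e0; pose g := patch (fun=> 0) (node S j) f.
have gf S' : node S j S' -> g S' = f S'.
  by move=> nS'; rewrite /g /patch ifT// inE.
have g0 S' : 0 <= g S'.
  by rewrite /g /patch; case: ifPn => //; rewrite inE; exact: f0.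
have : Ibar HH j g S <= a%:E.
  rewrite -sigma_eq_I//; apply: sigma_up_mono fa => S' /gf ->//.
move=> /Ibar_leP/(_ _ e0)[P [p [pP Pe gp]]].
by exists P, p; split=> // S' nS'; rewrite -gf// gp.
Qed.

(** The elementary functions form a cone without lattice operations. The substitute
    is to pass to the complement of r in a near-optimal majorant q: it is again
    non-negative and integrable, now with a small integral, so the step can be
    repeated. *)
Lemma complement_step r a (e : R) : (forall S', node S j S' -> 0 <= r S') ->
  has_integral r a -> (0 < e)%R ->
  exists Q q r', [/\ elem_series q Q, (Q <= a + e)%R, has_integral r' (Q - a) &
    forall S', node S j S' -> [/\ r S' <= q S', 0 <= r' S' & r S' + r' S' = q S']].
Proof.
move=> r0 ra e0; have [Q [q [qQ Qa rq]]] := ge0_dominated r0 (proj1 ra) e0.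
exists Q, q, (fun S' => (q S' - r S')%dE); split=> //.
  by apply: has_integralB => //; exact: has_integral_elem_series.
move=> S' nS'; split; [exact: rq|exact/dsube_ge0/rq|].
by apply: dsubeK; [exact: r0|exact: rq].
Qed.

(** Two complements in a row bring the remainder back with a positive sign, so that an
    iteration collects all the q on one side and all the u on the other. *)
Lemma remainder_step r a (e : R) : (forall S', node S j S' -> 0 <= r S') ->
  has_integral r a -> (0 < e)%R ->
  exists Q q U u r' a',
    [/\ elem_series q Q /\ (Q <= a + e)%R, elem_series u U /\ (U <= e)%R,
      has_integral r' a' /\ (a' <= e)%R &
    forall S', node S j S' ->
      [/\ r S' <= q S', 0 <= r' S' & r S' + u S' = q S' + r' S']].
Proof.
move=> r0 ra e0; have e20 : (0 < e / 2)%R by rewrite divr_gt0.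
have [Q [q [s [qQ Qa sQa rE]]]] := complement_step r0 ra e20.
have s0 S' : node S j S' -> 0 <= s S' by move=> /rE[].
have [U [u [r' [uU Us r'U sE]]]] := complement_step s0 sQa e20.
exists Q, q, U, u, r', (U - (Q - a))%R; split.
- by split=> //; lra.
- by split=> //; lra.
- by split=> //; lra.
- move=> S' nS'; have [rq s0' rsE] := rE _ nS'; have [su r'0 srE] := sE _ nS'.
  by split=> //; rewrite -srE -rsE addeA.
Qed.

(** The first n steps add up to
    r 0 + (u 0 + ... + u n.-1) = (q 0 + ... + q n.-1) + r n, and 0 <= r n <= q n puts
    this between two successive partial sums of q. The equality holds in [0, +oo],
    also where the series diverge. *)
Lemma squeeze_series (r q u : nat -> \bar R) :
  (forall n, 0 <= u n) -> (forall n, 0 <= r n) -> (forall n, r n <= q n) ->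
  (forall n, r n + u n = q n + r n.+1) ->
  r 0%N + \sum_(0 <= n <oo) u n = \sum_(0 <= n <oo) q n.
Proof.
move=> u0 r0 rq step.
have q0 n : 0 <= q n by exact: le_trans (rq n).
have partial n : r 0%N + \sum_(0 <= k < n) u k = \sum_(0 <= k < n) q k + r n.
  elim: n => [|n IH]; first by rewrite !big_geq// adde0 add0e.
  by rewrite !big_nat_recr//= addeA IH -addeA step addeA.
apply/eqP; rewrite eq_le; apply/andP; split; last first.
  apply: lime_le; first by apply: is_cvg_nneseries => n _ _.
  apply: nearW => n; apply: (@le_trans _ _ (r 0%N + \sum_(0 <= k < n) u k)).
    by rewrite partial leeDl.
  by rewrite leeD2l// nneseries_lim_ge.
rewrite -(eseries_cons (F := fun n => if n is n'.+1 then u n' else r 0%N))//; last first.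
  exact: lt_le_trans (r0 0%N).
apply: lime_le; first by apply: is_cvg_nneseries => -[|n] _ _.
apply: nearW => -[|n]; first by rewrite big_geq// nneseries_ge0.
rewrite big_nat_recl//= partial (@le_trans _ _ (\sum_(0 <= k < n.+1) q k))//.
  by rewrite big_nat_recr//= leeD2l.
exact: nneseries_lim_ge.
Qed.

(** Iterating remainder_step with summable tolerances exhausts f by the alternating
    series q 0 - u 0 + q 1 - u 1 + ...; the terms of equal sign are summed separately. *)
Lemma has_integral_ge0_diff f a (e : R) : (forall S', node S j S' -> 0 <= f S') ->
  has_integral f a -> (0 < e)%R ->
  exists U u V v, [/\ elem_series u U, elem_series v V, (U <= e)%R, V = (a + U)%R &
    forall S', node S j S' -> f S' + u S' = v S'].
Proof.
move=> f0 fa e0.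
(* The tolerances eps n sum to e. *)
pose eps n : R := (e / 2 ^+ n.+1)%R.
have eps0 n : (0 < eps n)%R by rewrite divr_gt0// exprn_gt0.
(* The iterated state is a remainder together with its integral. *)
pose good (x : (T -> \bar R) * R) :=
  (forall S', node S j S' -> 0 <= x.1 S') /\ has_integral x.1 x.2.
have /choice[F FE] : forall nx : nat * ((T -> \bar R) * R),
    exists y : (R * (T -> \bar R)) * (R * (T -> \bar R)) * ((T -> \bar R) * R),
    good nx.2 -> [/\ elem_series y.1.1.2 y.1.1.1 /\ (y.1.1.1 <= nx.2.2 + eps nx.1)%R,
      elem_series y.1.2.2 y.1.2.1 /\ (y.1.2.1 <= eps nx.1)%R,
      has_integral y.2.1 y.2.2 /\ (y.2.2 <= eps nx.1)%R &
      forall S', node S j S' -> [/\ nx.2.1 S' <= y.1.1.2 S', 0 <= y.2.1 S' &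
        nx.2.1 S' + y.1.2.2 S' = y.1.1.2 S' + y.2.1 S']].
  move=> [n [r b]]; have [[/= r0 rb]|] := pselect (good (r, b)); last first.
    by exists ((0%R, cst 0), (0%R, cst 0), (cst 0, 0%R)).
  have [Q [q [U [u [r' [b' [? ? ? ?]]]]]]] := remainder_step r0 rb (eps0 n).
  by exists ((Q, q), (U, u), (r', b')).
pose x := fix x n := if n is n'.+1 then (F (n', x n')).2 else (f, a).
have xgood n : good (x n).
  elim: n => [//|n IH] /=; have [_ _ [? _] rE] := FE (n, x n) IH.
  by split=> // S' /rE[].
have {FE}FE n := FE (n, x n) (xgood n).
pose q n := (F (n, x n)).1.1; pose u n := (F (n, x n)).1.2.
have qM n : elem_series (q n).2 (q n).1 by have [[]] := FE n.
have uM n : elem_series (u n).2 (u n).1 by have [_ []] := FE n.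
have [n|n|U Ue uU] := @nneseries_geometric R (fun n => (u n).1) e.
- exact: elem_series_cost_ge0 (uM n).
- by have [_ []] := FE n.
(* Dominating q n.+1 costs at most the integral of the remainder, which is at most
   eps n, plus eps n.+1; only q 0 has a price that is not controlled by e. *)
have [n|n|V' _ qV'] := @nneseries_geometric R (fun n => (q n.+1).1) (2 * e).
- exact: elem_series_cost_ge0 (qM _).
- have [_ _ [_ xe] _] := FE n; have [[_ qe] _ _ _] := FE n.+1.
  rewrite (le_trans qe)//= -mulrA.
  have : (eps n.+1 <= eps n)%R.
    by rewrite ler_pM2l// lef_pV2 ?posrE ?exprn_gt0// ler_weXn2l// ler1n.
  by rewrite -/(eps n); lra.
have uS := elem_series_sum uM uU.
have qV : \sum_(0 <= n <oo) (q n).1%:E = ((q 0%N).1 + V')%:E.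
  rewrite eseries_cons ?ltNyr// ?qV'//.
  by move=> n; rewrite lee_fin; exact: elem_series_cost_ge0 (qM _).
have qS := elem_series_sum qM qV.
have fu S' : node S j S' ->
    f S' + \sum_(0 <= n <oo) (u n).2 S' = \sum_(0 <= n <oo) (q n).2 S'.
  move=> nS'; apply: (@squeeze_series (fun n => (x n).1 S')).
  - by move=> n; exact: elem_series_ge0 (uM n) nS'.
  - by move=> n; have [/(_ _ nS')] := xgood n.
  - by move=> n; have [_ _ _ /(_ _ nS')[]] := FE n.
  - by move=> n; have [_ _ _ /(_ _ nS')[]] := FE n.
exists U, (fun S' => \sum_(0 <= n <oo) (u n).2 S').
exists ((q 0%N).1 + V')%R, (fun S' => \sum_(0 <= n <oo) (q n).2 S'); split=> //.
apply: (has_integral_uniq (has_integral_elem_series qS)).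
apply: has_integral_congr (has_integralD fa (has_integral_elem_series uS)) => S' nS'.
by rewrite -fu// daddeE_ge0// ?f0// (elem_series_ge0 uS nS').
Qed.

(** A near-optimal superhedge p - b exceeds f by a non-negative integrable function of
    small integral, to which has_integral_ge0_diff applies. A finite part of p goes
    into the elementary difference, and the remaining tail has small integral. *)
Lemma has_integral_diff f a (e : R) : has_integral f a -> (0 < e)%R ->
  exists G g B b U u V v, [/\ elem G g /\ elem B b, elem_series u U /\ elem_series v V,
    (U <= e)%R /\ (V <= e)%R &
    node_null (fun S' => f S' <> ((g S' - b S')%:E + v S' - u S')%dE)].
Proof.
move=> fa e0; have e40 : (0 < e / 4)%R by rewrite divr_gt0.
have /sigma_up_leP/(_ _ e40)[B [b [P [p [bB pP PB fp]]]]] := proj1 fa.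
pose r S' := ((p S' - (b S')%:E) - f S')%dE.
have pbE S' : (p S' - (b S')%:E)%dE = p S' - (b S')%:E by case: (p S').
have ra : has_integral r (P - B - a).
  apply: has_integralB => //; apply: has_integralB (has_integral_elem bB).
  exact: has_integral_elem_series.
have r0 S' : node S j S' -> 0 <= r S'.
  by move=> nS'; apply: dsube_ge0; rewrite pbE; exact: fp.
have [U [u [V [v [uU vV Ue VE ruE]]]]] := has_integral_ge0_diff r0 ra e40.
have [G [g [Q [t [gG tQ Qe PE pE]]]]] := elem_series_split pP e40.
exists G, g, B, b, V, v, (Q + U)%R, (fun S' => t S' + u S'); split=> //.
- by split=> //; exact: elem_seriesD.
- by split; lra.
have poles := node_nullU (elem_series_pinfty_null pP) (elem_series_pinfty_null vV).
apply: node_null_sub poles => S' nS' fE.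
have [poo|pfin] := eqVneq (p S') +oo; first by left.
right; apply/eqP; apply: contrapT => /negP vfin; apply: fE.
apply: dsube_regroup (ruE _ nS') (pE _ nS') pfin vfin.
- exact: elem_series_ge0 tQ nS'.
- exact: elem_series_ge0 uU nS'.
- exact: r0.
Qed.

End elementary.

(** * From nodes to the whole trajectory set *)

Section gluing.
Set Implicit Arguments.
Unset Strict Implicit.
Variables (R : realType) (T : set (nat -> R)).
Variables (HH : T -> nat -> set (nat -> T -> R)).
Hypothesis portf : portfolio_family HH.
Variable j : nat.
Implicit Types S : T.
Local Open Scope ereal_scope.

Lemma node_eq S S' : node S j S' -> node S' j = node S j.
Proof.
move=> nS'; apply/seteqP; split=> S'' nS'' i ij; first by rewrite nS''// nS'.
by rewrite nS''// nS'.
Qed.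

Lemma represents_node S S' : node S j S' ->
  represents HH S' j = represents HH S j.
Proof.
by move=> nS'; rewrite /represents (portfolio_node portf nS') (node_eq nS').
Qed.

Lemma Dnode_pos_node S S' : node S j S' -> Dnode_pos HH S' j = Dnode_pos HH S j.
Proof.
by move=> nS'; rewrite /Dnode_pos /Dnode (represents_node nS') (node_eq nS').
Qed.

Lemma Iop_node S S' (g g' : T -> R) : node S j S' ->
  (forall S'', node S j S'' -> g S'' = g' S'') -> Iop HH j g S = Iop HH j g' S'.
Proof.
move=> nS' gg'; rewrite /Iop (represents_node nS'); congr xget.
apply/seteqP; split=> V; apply: represents_congr => S'' nS''; rewrite gg'//.
Qed.

Lemma Ibar_node_le S S' (f f' : T -> \bar R) : node S j S' ->
  (forall S'', node S j S'' -> f S'' = f' S'') ->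
  Ibar HH j f S <= Ibar HH j f' S'.
Proof.
move=> nS' ff'; apply: ereal_inf_le_tmp => _ [V [g [gV fg ->]]].
exists V, g; split=> //.
  by move=> m; rewrite -(represents_node nS') -(Dnode_pos_node nS').
by move=> S'' nS''; rewrite ff'// fg// (node_eq nS').
Qed.

Lemma Ibar_node S S' (f f' : T -> \bar R) : node S j S' ->
  (forall S'', node S j S'' -> f S'' = f' S'') ->
  Ibar HH j f S = Ibar HH j f' S'.
Proof.
move=> nS' ff'; apply/eqP; rewrite eq_le !Ibar_node_le//.
  by move=> i ij; rewrite nS'.
by move=> S''; rewrite (node_eq nS') => /ff' ->.
Qed.

Lemma ae_node_transport S S' (P P' : T -> Prop) : node S j S' ->
  (forall S'', node S j S'' -> P S'' <-> P' S'') ->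
  ae_node HH S j P -> ae_node HH S' j P'.
Proof.
move=> nS' PP'; rewrite /ae_node /norm_at => <-; apply/esym/Ibar_node => //.
move=> S'' nS''; rewrite (node_eq nS'); congr (`|(\1_ _ _)%:E|).
by apply/seteqP; split=> S3 [nS3 nP]; split=> //= /(PP' _ nS3).
Qed.

Lemma Dnode_pos_glob S g : Dnode_pos HH S j g -> Dglob_pos HH j g.
Proof.
move=> [[[V gV] gout] g0]; split=> // S'.
have [nS'|nS'] := pselect (node S j S').
  by exists V; rewrite (represents_node nS').
exists 0%R; apply: represents_congr (represents0 portf S' j) => S'' nS''.
by rewrite gout// => nS; apply: nS' => i ij; rewrite -nS''// nS.
Qed.

Lemma Enode_glob S h : Enode HH S j h -> Eglob HH j h.
Proof.
move=> [p pD [q qD <-]].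
by exists p; [exact: Dnode_pos_glob pD|exists q => //; exact: Dnode_pos_glob qD].
Qed.

Lemma Dglob_pos0 : Dglob_pos HH j (fun=> 0%R).
Proof. by split=> // S; exists 0%R; exact: represents0. Qed.

(** Membership in D_j is a condition on each node separately, so choosing one point of
    D in every node that meets D and using its functions on the whole node yields
    global ones. *)
Lemma glue_Dglob_pos (I : Type) (D : set T) (P : T -> (I -> T -> R) -> Prop) :
  (forall S S' g g', node S j S' ->
     (forall i S'', node S j S'' -> g i S'' = g' i S'') -> P S g -> P S' g') ->
  (forall S, D S -> exists g, (forall i, Dglob_pos HH j (g i)) /\ P S g) ->
  exists g, (forall i, Dglob_pos HH j (g i)) /\ (forall S, D S -> P S g).
Proof.
move=> Pnode Pex.
have [S0|noS] := pselect (exists S0 : T, True); last first.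
  by exists (fun _ _ => 0%R); split=> [i|S]; [exact: Dglob_pos0|case: noS; exists S].
case: S0 => S0 _.
have /choice[F FE] : forall S, exists g : I -> T -> R,
    (forall i, Dglob_pos HH j (g i)) /\ (D S -> P S g).
  move=> S; have [/Pex[g [gD gP]]|nD] := pselect (D S); first by exists g.
  by exists (fun _ _ => 0%R); split=> // i; exact: Dglob_pos0.
(* The representative depends on S only through its node. *)
pose rep S := xget S0 [set S' | node S j S' /\ D S'].
have rep_node S S' : node S j S' -> rep S' = rep S.
  by move=> nS'; rewrite /rep (node_eq nS').
exists (fun i S => F (rep S) i S); split=> [i|S DS].
- split=> [S|S]; last by have [/(_ i)[_]] := FE (rep S).
  have [/(_ i)[/(_ S)[V FV] _] _] := FE (rep S).
  by exists V; apply: represents_congr FV => S' nS'; rewrite (rep_node _ _ nS').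
- have [nrep Drep] : node S j (rep S) /\ D (rep S).
    by apply: (@xgetPex _ S0 [set S' | node S j S' /\ D S']); exists S.
  have [_ /(_ Drep)] := FE (rep S); apply: Pnode.
    by move=> i ij; rewrite nrep.
  move=> i S'; rewrite (node_eq nrep) => nS'.
  by rewrite (rep_node _ _ nS').
Qed.

Section sums.
Hypothesis sigma0 : forall S, sigma_up HH j (fun=> 0%E) S = 0%E.

Lemma Dglob_pos_elem_series S (g : nat -> T -> R) :
  (forall m, Dglob_pos HH j (g m)) ->
  \sum_(0 <= m <oo) (Iop HH j (g m) S)%:E < +oo ->
  exists a, elem_series HH S j (fun S' => \sum_(0 <= m <oo) (g m S')%:E) a.
Proof.
move=> gD fin.
have el m : elem HH S j (Iop HH j (g m) S) (patch (fun=> 0%R) (node S j) (g m)).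
  have [/(_ S) gV g0] := gD m; apply: elem_restrict => //.
  exact: (@xgetPex _ 0%R [set V | represents HH S j V (g m)]).
have I0 m : 0 <= (Iop HH j (g m) S)%:E.
  exact: elem_cost_fin_ge0 (el m).
exists (fine (\sum_(0 <= m <oo) (Iop HH j (g m) S)%:E)).
exists (fun m => Iop HH j (g m) S).
exists (fun m => patch (fun=> 0%R) (node S j) (g m)); split=> //.
  move=> S' nS'; apply: eq_eseriesr => m _; rewrite /patch ifT// inE//.
by rewrite fineK// ge0_fin_numE// nneseries_ge0.
Qed.

Lemma Mat_elem_series S v : Mat HH j S v -> exists a, elem_series HH S j v a.
Proof.
move=> [g [gD vE /(Dglob_pos_elem_series gD)[a ga]]]; exists a.
by apply: elem_series_congr ga => S' _; rewrite vE.
Qed.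

(** The initial capital of a non-negative payoff is unique, hence Iop returns the
    prices with which the series was built. *)
Lemma elem_series_Mat S v a : elem_series HH S j v a ->
  exists v', Mat HH j S v' /\ forall S', node S j S' -> v' S' = v S'.
Proof.
move=> [V [g [gV vE Va]]]; exists (fun S' => \sum_(0 <= m <oo) (g m S')%:E).
split; last by move=> S' /vE.
exists g; split=> //.
  by move=> m; apply: (@Dnode_pos_glob S); have [] := gV m.
rewrite (eq_eseriesr (g := fun m => (V m)%:E)) ?Va ?ltry// => m _.
have [gD gr] := gV m; congr EFin.
apply: (represents_uniq portf (sigma0 S) _ _ gr); first by case: gD.
by apply: (@xgetPex _ 0%R [set V | represents HH S j V (g m)]); exists (V m).
Qed.

Lemma Mae_ge0 v S' : Mae HH j v -> 0 <= v S'.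
Proof.
move=> [g [gD -> _]]; apply: nneseries_ge0 => m _ _.
by rewrite lee_fin; have [_] := gD m.
Qed.

Lemma Mat_Ibar S v : Mat HH j S v -> Ibar HH j v S < +oo.
Proof.
move=> /Mat_elem_series[a /(elem_series_Ibar_le portf (sigma0 S)) va].
by rewrite (le_lt_trans va)// ltry.
Qed.

Lemma Dglob_pos_has_integral S p : Dglob_pos HH j p ->
  exists a, has_integral HH S j (EFin \o p) a.
Proof.
move=> [/(_ S)[V pV] p0]; exists V.
apply: (has_integral_congr portf (sigma0 S)); last first.
  exact: has_integral_elem (elem_restrict p0 pV).
by move=> S' nS'; congr EFin; rewrite /patch ifT// inE.
Qed.

Lemma Mat_has_integral S v : Mat HH j S v -> exists a, has_integral HH S j v a.
Proof. by move=> /Mat_elem_series[a va]; exists a; exact: has_integral_elem_series. Qed.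

Lemma Mat_diff_has_integral S f u v : Mat HH j S u -> Mat HH j S v ->
  ae_node HH S j (fun S' => f S' = (v S' - u S')%dE) ->
  exists a, has_integral HH S j f a.
Proof.
move=> /Mat_has_integral[a ua] /Mat_has_integral[b vb] /(ae_nodeP portf (sigma0 S)) fE.
exists (b - a)%R.
apply: (has_integral_ae portf (sigma0 S)) (has_integralB _ _ vb ua) => //.
by apply: node_null_sub fE => S' _ ne eqf; apply: ne; rewrite -eqf.
Qed.

End sums.
End gluing.

(** * Comparison of the classes *)

Section classes.
Set Implicit Arguments.
Unset Strict Implicit.
Variables (R : realType) (T : set (nat -> R)).
Variables (HH : T -> nat -> set (nat -> T -> R)).
Hypothesis portf : portfolio_family HH.
Hypothesis sigma0 : forall i (S : T), sigma_up HH i (fun=> 0%E) S = 0%E.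
Variable j : nat.
Hypothesis sigma_eq_I : forall f : T -> \bar R, (forall S, (0 <= f S)%E) ->
  forall S, sigma_up HH j f S = Ibar HH j f S.
Local Open Scope ereal_scope.

Lemma null_setP (E : set T) : Defs.null_set HH E <-> forall S : T, node_null HH S 0 E.
Proof. by split=> nE S; apply/(node_nullP portf (sigma0 0 S)); exact: nE. Qed.

Lemma ae_mono (P Q : T -> Prop) : (forall S, P S -> Q S) -> ae HH P -> ae HH Q.
Proof. by move=> PQ [E nE EP]; exists E => // S /EP/PQ. Qed.

Lemma ae_and (P Q : T -> Prop) : ae HH P -> ae HH Q -> ae HH (fun S => P S /\ Q S).
Proof.
move=> [E /null_setP nE EP] [F /null_setP nF FQ]; exists (E `|` F).
  by apply/null_setP => S; exact: (node_nullU portf (sigma0 0 S)).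
by move=> S /not_orP[/EP ? /FQ].
Qed.

Lemma LsigmaP f : Lsigma HH j f <-> ae HH (fun S => exists a, has_integral HH S j f a).
Proof. by split; apply: ae_mono => S /(has_integralP portf (sigma0 j S)). Qed.

Lemma Mae_Mat v : Mae HH j v -> ae HH (fun S => Mat HH j S v).
Proof. by move=> [g [gD vE]]; apply: ae_mono => S gfin; exists g. Qed.

Lemma Lsigma_pos_L : Lsigma_pos HH j `<=` L HH j.
Proof.
move=> f [/LsigmaP fs f0]; split=> //; apply: ae_mono fs => S [a fa] e e0.
have [U [u [V [v [uU vV Ue _ fuv]]]]] :=
  has_integral_ge0_diff portf (sigma0 j S) (fun g g0 => sigma_eq_I g0 S)
    (fun S' _ => f0 S') fa e0.
have [u' [u'M u'E]] := elem_series_Mat portf (sigma0 j) uU.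
have [v' [v'M v'E]] := elem_series_Mat portf (sigma0 j) vV.
exists u', v'; split=> //.
  apply/(ae_nodeP portf (sigma0 j S)).
  apply: node_null_sub (elem_series_pinfty_null uU) => S' nS' fE.
  apply: contrapT => /eqP ufin; apply: fE; rewrite u'E// v'E// -fuv//.
  by rewrite adde_dsubeK//; exact: elem_series_ge0 uU nS'.
apply: le_trans (_ : U%:E <= _); last by rewrite lee_fin.
by rewrite (Ibar_node portf (@node_refl _ _ S j) u'E); exact: elem_series_Ibar_le.
Qed.

Lemma Lsigma_LK : Lsigma HH j `<=` LK HH j.
Proof.
move=> f /LsigmaP fs; apply: ae_mono fs => S [a fa] e e0.
have [G [g [B [b [U [u [V [v [[gG bB] [uU vV] [Ue Ve] fE]]]]]]]]] :=
  has_integral_diff portf (sigma0 j S) (fun g g0 => sigma_eq_I g0 S) fa e0.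
have [u' [u'M u'E]] := elem_series_Mat portf (sigma0 j) uU.
have [v' [v'M v'E]] := elem_series_Mat portf (sigma0 j) vV.
have le_e w w' W : elem_series HH S j w W -> (W <= e)%R ->
    (forall S', node S j S' -> w' S' = w S') -> Ibar HH j w' S <= e%:E.
  move=> wW We w'E; apply: le_trans (_ : W%:E <= _); last by rewrite lee_fin.
  by rewrite (Ibar_node portf (@node_refl _ _ S j) w'E); exact: elem_series_Ibar_le.
exists u', v', (fun S' => g S' - b S')%R; split=> //.
- exists g; first by case: gG.
  by exists b => //; case: bB.
- apply/(ae_nodeP portf (sigma0 j S)).
  by apply: node_null_sub fE => S' nS'; rewrite u'E// v'E.
- exact: le_e uU Ue u'E.
- exact: le_e vV Ve v'E.
Qed.

Lemma eq_eseries_fin (g g' : nat -> R) : (forall m, g m = g' m) ->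
  \sum_(0 <= m <oo) (g m)%:E = \sum_(0 <= m <oo) (g' m)%:E.
Proof. by move=> gg'; apply: eq_eseriesr => m _; rewrite gg'. Qed.

(** The nodes that meet the complement of the exceptional set are glued; the
    exceptional set does not change. *)
Lemma L_LG : L HH j `<=` LG HH j.
Proof.
move=> f [f0 [E nE fE]]; split=> // e e0.
pose sum (g : nat -> T -> R) S' := \sum_(0 <= m <oo) (g m S')%:E.
(* The functions indexed by (true, m) are the terms of v, those by (false, m) the
   terms of u. *)
pose P S (g : bool * nat -> T -> R) :=
  [/\ forall b, \sum_(0 <= m <oo) (Iop HH j (g (b, m)) S)%:E < +oo,
      ae_node HH S j (fun S' =>
        f S' = (sum (fun m => g (true, m)) S' - sum (fun m => g (false, m)) S')%dE) &
      Ibar HH j (sum (fun m => g (false, m))) S <= e%:E].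
have Pnode S S' g g' : node S j S' ->
    (forall i S'', node S j S'' -> g i S'' = g' i S'') -> P S g -> P S' g'.
  move=> nS' gg'.
  have sumE b S'' : node S j S'' ->
      sum (fun m => g (b, m)) S'' = sum (fun m => g' (b, m)) S''.
    by move=> nS''; apply: eq_eseries_fin => m; exact: gg'.
  move=> [fin fg small]; split.
  - move=> b; rewrite -(eq_eseries_fin (g := fun m => Iop HH j (g (b, m)) S))//.
    by move=> m; apply: Iop_node => // S'' /gg'.
  - by apply: ae_node_transport fg => // S'' nS''; rewrite !sumE.
  - by rewrite -(Ibar_node portf nS' (sumE false)).
have [S nES|g [gD gP]] := glue_Dglob_pos portf (D := ~` E) Pnode.
  have [u [v [[gu [guD uE ufin]] [gv [gvD vE vfin]] fuv ue]]] := fE S nES e e0.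
  have {}uE : u = sum gu by apply/funext.
  have {}vE : v = sum gv by apply/funext.
  exists (fun i => if i.1 then gv i.2 else gu i.2); split.
    by move=> [[] m] /=.
  by split; [case|rewrite uE vE in fuv|rewrite -uE].
exists (sum (fun m => g (false, m))), (sum (fun m => g (true, m))).
have fin b : ae HH (fun S =>
    \sum_(0 <= m <oo) (Iop HH j (g (b, m)) S)%:E < +oo).
  by exists E => // S /gP[].
split.
- by exists (fun m => g (false, m)).
- by exists (fun m => g (true, m)).
- exists E => // S /gP[Pfin ? ?]; split=> //.
  by apply: (Mat_Ibar portf (sigma0 j)); exists (fun m => g (true, m)); split.
Qed.

(** Members of M_j(S) have an integral at the node, hence so has v - u, and a single
    tolerance is enough. *)
Lemma LG_Lsigma_pos : LG HH j `<=` Lsigma_pos HH j.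
Proof.
move=> f [f0 /(_ 1%R ltr01)[u [v [uM vM fuv]]]]; split=> //; apply/LsigmaP.
apply: ae_mono (ae_and (ae_and (Mae_Mat uM) (Mae_Mat vM)) fuv).
by move=> S [[uS vS] [fE _ _]]; exact: Mat_diff_has_integral uS vS fE.
Qed.

Lemma LK_LKG : LK HH j `<=` LKG HH j.
Proof.
move=> f [E nE fE] e e0.
pose sum (g : nat -> T -> R) S' := \sum_(0 <= m <oo) (g m S')%:E.
(* (true, Some m) and (false, Some m) index the terms of v and u, and (true, None) and
   (false, None) the two functions whose difference is h. *)
pose P S (g : bool * option nat -> T -> R) :=
  [/\ forall b, \sum_(0 <= m <oo) (Iop HH j (g (b, Some m)) S)%:E < +oo,
      ae_node HH S j (fun S' => f S' =
        ((g (true, None) S' - g (false, None) S')%:E +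
         sum (fun m => g (true, Some m)) S' - sum (fun m => g (false, Some m)) S')%dE) &
      forall b, Ibar HH j (sum (fun m => g (b, Some m))) S <= e%:E].
have Pnode S S' g g' : node S j S' ->
    (forall i S'', node S j S'' -> g i S'' = g' i S'') -> P S g -> P S' g'.
  move=> nS' gg'.
  have sumE b S'' : node S j S'' ->
      sum (fun m => g (b, Some m)) S'' = sum (fun m => g' (b, Some m)) S''.
    by move=> nS''; apply: eq_eseries_fin => m; exact: gg'.
  move=> [fin fg small]; split.
  - move=> b; rewrite -(eq_eseries_fin (g := fun m => Iop HH j (g (b, Some m)) S))//.
    by move=> m; apply: Iop_node => // S'' /gg'.
  - by apply: ae_node_transport fg => // S'' nS''; rewrite !sumE// !gg'.
  - by move=> b; rewrite -(Ibar_node portf nS' (sumE b)).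
have [S nES|g [gD gP]] := glue_Dglob_pos portf (D := ~` E) Pnode.
  have [u [v [h [[uM vM] hE fuv ue ve]]]] := fE S nES e e0.
  have [p pD [q qD hpq]] := Enode_glob portf hE.
  case: uM => [gu [guD uE ufin]]; case: vM => [gv [gvD vE vfin]].
  have {}uE : u = sum gu by apply/funext.
  have {}vE : v = sum gv by apply/funext.
  exists (fun i => match i with
    | (true, Some m) => gv m | (false, Some m) => gu m
    | (true, None) => p | (false, None) => q end); split.
    by move=> [[] [m|]] /=.
  by split; [case|rewrite uE vE -hpq in fuv|case; rewrite -?uE -?vE].
exists (sum (fun m => g (false, Some m))), (sum (fun m => g (true, Some m))).
exists (fun S => g (true, None) S - g (false, None) S)%R.
have fin b : ae HH (fun S =>
    \sum_(0 <= m <oo) (Iop HH j (g (b, Some m)) S)%:E < +oo).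
  by exists E => // S /gP[].
split.
- by exists (fun m => g (false, Some m)).
- by exists (fun m => g (true, Some m)).
- by exists (g (true, None)) => //; exists (g (false, None)).
- by exists E => // S /gP[].
Qed.

(** Writing h = p - q, the function f is the difference of p + v and q + u almost
    everywhere on almost every node. At the other points these two are replaced by the
    positive and negative parts of f, so that the difference is exact everywhere. *)
Lemma LKG_diff : LKG HH j `<=` Lsigma_pos_diff HH j.
Proof.
move=> f /(_ 1%R ltr01)[u [v [h [uM vM [p pD [q qD <-]] fuv]]]].
pose good S := f S = ((p S)%:E + v S - ((q S)%:E + u S)%E)%dE.
pose g S := if `[< good S >] then (p S)%:E + v S else maxe (f S) 0.
pose k S := if `[< good S >] then (q S)%:E + u S else maxe (- f S) 0.
have pos r w : Dglob_pos HH j r -> Mae HH j w -> forall S, 0 <= (r S)%:E + w S.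
  by move=> [_ r0] wM S; rewrite adde_ge0 ?lee_fin// (Mae_ge0 _ wM).
have aeok : ae HH (fun S => [/\ Mat HH j S u, Mat HH j S v &
    node_null HH S j (fun S' => ~ good S')]).
  apply: ae_mono (ae_and (ae_and (Mae_Mat uM) (Mae_Mat vM)) fuv).
  move=> S [[uS vS] [/(ae_nodeP portf (sigma0 j S)) fE _ _]]; split=> //.
  apply: node_null_sub fE => S' _ + fE; apply; rewrite /good fE.
  by apply: dsube_shuffle; rewrite (Mae_ge0 _ uM, Mae_ge0 _ vM).
have integral_sum S r w : Dglob_pos HH j r -> Mat HH j S w -> Mae HH j w ->
    exists a, has_integral HH S j (fun S' => (r S')%:E + w S') a.
  move=> rD wS wM; have [a ra] := Dglob_pos_has_integral portf (sigma0 j) S rD.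
  have [b wb] := Mat_has_integral portf (sigma0 j) wS.
  exists (a + b)%R; apply: (has_integral_congr portf (sigma0 j S)) _
    (has_integralD portf (sigma0 j S) ra wb).
  by move=> S' _; rewrite daddeE_ge0 ?lee_fin ?(Mae_ge0 _ wM)//; case: rD.
exists g; [split; [apply/LsigmaP|]|exists k; [split; [apply/LsigmaP|]|]].
- apply: ae_mono aeok => S [uS vS ok].
  have [a ga] := integral_sum S _ _ pD vS vM.
  exists a; apply: (has_integral_ae portf (sigma0 j S)) ga.
  apply: node_null_sub ok => S' _.
  by apply: contra_not => ?; rewrite /g ifT//; exact/asboolP.
- by move=> S; rewrite /g; case: ifP => _; [exact: pos|rewrite le_max lexx orbT].
- apply: ae_mono aeok => S [uS vS ok].
  have [a ka] := integral_sum S _ _ qD uS uM.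
  exists a; apply: (has_integral_ae portf (sigma0 j S)) ka.
  apply: node_null_sub ok => S' _.
  by apply: contra_not => ?; rewrite /k ifT//; exact/asboolP.
- by move=> S; rewrite /k; case: ifP => _; [exact: pos|rewrite le_max lexx orbT].
- apply/funext => S; rewrite /g /k; case: asboolP => [<-//|_].
  exact: dsube_pos_neg.
Qed.

Lemma diff_Lsigma : Lsigma_pos_diff HH j `<=` Lsigma HH j.
Proof.
move=> _ [g [/LsigmaP gs _] [k [/LsigmaP ks _] <-]]; apply/LsigmaP.
apply: ae_mono (ae_and gs ks) => S [[a ga] [b kb]].
by exists (a - b)%R; exact: has_integralB.
Qed.

End classes.

Theorem theorem4 (R : realType) (s0 : R) (T : set (nat -> R))
    (HH : T -> nat -> set (nat -> T -> R))
    (traj : trajectory_set s0 T)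
    (portf : portfolio_family HH)
    (neutral : locally_0_neutral T)
    (sigma0 : forall (i : nat) (S : T), sigma_up HH i (fun=> 0%E) S = 0%E)
    (j : nat)
    (sigma_eq_I : forall f : T -> \bar R, (forall S, (0 <= f S)%E) ->
       forall S, sigma_up HH j f S = Ibar HH j f S) :
  (Lsigma_pos HH j = L HH j /\ L HH j = LG HH j) /\
  [/\ Lsigma HH j = LK HH j, LK HH j = LKG HH j &
      LKG HH j = Lsigma_pos_diff HH j].
Proof.
have sL := Lsigma_pos_L portf sigma0 sigma_eq_I.
have LLG := L_LG portf sigma0 (j := j).
have LGs := LG_Lsigma_pos portf sigma0 (j := j).
have sLK := Lsigma_LK portf sigma0 sigma_eq_I.
have LKK := LK_LKG portf (j := j).
have Kd := LKG_diff portf sigma0 (j := j).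
have ds := diff_Lsigma portf sigma0 (j := j).
split; [split|split]; apply/seteqP; split=> //.
- exact: subset_trans LGs.
- exact: subset_trans LGs sL.
- exact: subset_trans LKK (subset_trans Kd ds).
- exact: subset_trans Kd (subset_trans ds sLK).
- exact: subset_trans ds (subset_trans sLK LKK).
Qed.
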